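(* Let $G_{18}$ be the graph on the $18$ vertices $x_i,a_i,b_i,c_i,d_i,e_i,f_i,g_i,h_i$ ($i=1,2$) with edge set $$\bigcup_{i=1}^{2}\{x_ia_i,\ x_ib_i,\ a_ic_i,\ b_id_i,\ c_id_i,\ c_ie_i,\ d_if_i,\ e_ig_i,\ e_ih_i,\ f_ig_i,\ f_ih_i\}\cup\{x_1x_2\}.$$ Then $G_{18}$ is connected, subcubic (maximum degree at most $3$), has no $K_4$ minor, and has no crumby coloring.
   Context: A red-blue coloring of the vertices of a graph is called crumby if (1) the subgraph induced by the blue vertices has maximum degree at most $1$, (2) every red vertex has at least one red neighbour, and (3) the subgraph induced by the red vertices contains no path on four vertices as a subgraph (not necessarily induced), i.e., there are no four distinct red vertices $v_1,v_2,v_3,v_4$ with $v_1v_2,v_2v_3,v_3v_4$ edges. *)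

(* Defs.v *)
From HB Require Import structures.
From mathcomp Require Import all_boot.

Set Implicit Arguments.
Unset Strict Implicit.
Unset Printing Implicit Defensive.

Record sgraph := SGraph {
  svertex :> finType;
  adj : rel svertex;
  adj_sym : symmetric adj;
  adj_irrefl : irreflexive adj
}.

Definition max_degree (G : sgraph) : nat := \max_(v : G) #|[set w | adj v w]|.

(* The empty graph is not connected. *)
Definition connected_graph (G : sgraph) : Prop :=
  0 < #|G| /\ forall u v : G, connect (@adj G) u v.

Section Induced.
Variables (G : sgraph) (S : {set G}).

Definition induced_adj : rel {x : G | x \in S} :=
  fun u v => adj (val u) (val v).

Fact induced_adj_sym : symmetric induced_adj.
Proof. by move=> u v; apply: adj_sym. Qed.

Fact induced_adj_irrefl : irreflexive induced_adj.
Proof. by move=> u; apply: adj_irrefl. Qed.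

Definition induced : sgraph := SGraph induced_adj_sym induced_adj_irrefl.
End Induced.

Section Complete.
Variable n : nat.

Definition complete_adj : rel 'I_n := fun i j => i != j.

Fact complete_adj_sym : symmetric complete_adj.
Proof. by move=> i j; rewrite /complete_adj eq_sym. Qed.

Fact complete_adj_irrefl : irreflexive complete_adj.
Proof. by move=> i; rewrite /complete_adj eqxx. Qed.

Definition complete_graph : sgraph :=
  SGraph complete_adj_sym complete_adj_irrefl.
End Complete.

(* H is a minor of G iff G has a minor model of H: pairwise disjoint connected
   (so nonempty) branch sets, joined by an edge of G whenever the
   corresponding vertices of H are adjacent. *)
Definition has_minor (H G : sgraph) : Prop :=
  exists phi : H -> {set G},
    [/\ forall h, connected_graph (induced (phi h)),
        forall h k, h != k -> [disjoint phi h & phi k]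
      & forall h k, adj h k ->
          exists x y : G, [/\ x \in phi h, y \in phi k & adj x y]].

Variant color := Red | Blue.

Definition is_red (c : color) : bool := if c is Red then true else false.
Definition color_of_bool (b : bool) : color := if b then Red else Blue.
Fact is_redK : cancel is_red color_of_bool. Proof. by case. Qed.
HB.instance Definition _ := Finite.copy color (can_type is_redK).

Definition crumby (G : sgraph) (c : G -> color) : Prop :=
  [/\ max_degree (induced [set v | c v == Blue]) <= 1,
      forall v, c v = Red -> exists2 w, adj v w & c w = Red
    & ~ exists v1 v2 v3 v4 : G,
          [/\ uniq [:: v1; v2; v3; v4],
              [/\ c v1 = Red, c v2 = Red, c v3 = Red & c v4 = Red]
            & [/\ adj v1 v2, adj v2 v3 & adj v3 v4]]].

Variant letter := X_ | A_ | B_ | C_ | D_ | E_ | F_ | G_ | H_.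

Definition letters := [:: X_; A_; B_; C_; D_; E_; F_; G_; H_].

Definition letter_index (l : letter) : nat :=
  match l with
  | X_ => 0 | A_ => 1 | B_ => 2 | C_ => 3 | D_ => 4
  | E_ => 5 | F_ => 6 | G_ => 7 | H_ => 8
  end.

Fact letter_indexK : cancel letter_index (nth X_ letters).
Proof. by case. Qed.
HB.instance Definition _ := Countable.copy letter (can_type letter_indexK).

Fact letters_enum : Finite.axiom letters. Proof. by case. Qed.
HB.instance Definition _ := isFinite.Build letter letters_enum.

(* (false, l) is the vertex l_1 and (true, l) is the vertex l_2. *)
Definition G18_vertex : finType := (bool * letter)%type.

Definition half_edges : seq (letter * letter) :=
  [:: (X_, A_); (X_, B_); (A_, C_); (B_, D_); (C_, D_); (C_, E_);
      (D_, F_); (E_, G_); (E_, H_); (F_, G_); (F_, H_)].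

Definition G18_edges : seq (G18_vertex * G18_vertex) :=
  ((false, X_), (true, X_)) ::
  [seq ((i, p.1), (i, p.2)) | i <- [:: false; true], p <- half_edges].

Definition G18_adj : rel G18_vertex :=
  fun u v => ((u, v) \in G18_edges) || ((v, u) \in G18_edges).

Fact G18_adj_sym : symmetric G18_adj.
Proof. by move=> u v; rewrite /G18_adj orbC. Qed.

Fact G18_adj_irrefl : irreflexive G18_adj.
Proof. by case=> [[] []]. Qed.

Definition G18 : sgraph := SGraph G18_adj_sym G18_adj_irrefl.

Fact card_G18 : #|G18| = 18.
Proof. by rewrite card_prod card_bool cardT enumT unlock. Qed.

(* Main.v *)
(** No K_4 minor: G18 has an elimination ordering in which, for every vertex v,
    the component D of v among the vertices up to v has at most two neighbours,
    all later than v.  Given disjoint connected pairwise adjacent branch sets,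
    take the one whose last vertex v comes first: it lies in D, so every other
    branch set, being adjacent to it and not contained in D, meets the
    neighbourhood of D.  Hence there are at most three branch sets.

    No crumby coloring: up to the edge x1 x2, each half of G18 has few
    colorings satisfying the crumby conditions (the condition on red vertices
    being waived at x), and in all of them x and one of a, b are red.  The two
    halves then form a red path on four vertices through the edge x1 x2. *)
Require Import Defs.
From HB Require Import structures.
From mathcomp Require Import all_boot.

(** A path inside [S] that starts in [D] could leave [D] only through [N], which [S] avoids. *)
Lemma connected_subset_of_boundary (G : sgraph) (S : {set G}) (D N : pred G) :
  connected_graph (induced S) ->
  (forall w u, w \in D -> adj w u -> (u \in D) || (u \in N)) ->
  (forall u, u \in S -> u \notin N) ->
  forall x, x \in S -> x \in D -> {subset S <= D}.
Proof.
move=> [_ conS] bdD SN x xS xD y yS.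
have /connectP [p] := conS (Sub x xS) (Sub y yS).
rewrite -[y in _ -> y \in _]/(val (Sub y yS : induced S)) => + ->.
elim: p (Sub x xS : induced S) (xD : val (Sub x xS : induced S) \in D)
  => [|z p IHp] //= w wD /andP [wz zp].
apply: IHp zp; have := bdD _ _ wD wz.
by rewrite (negbTE (SN _ (valP z))) orbF.
Qed.

(** The hypotheses are the elimination form of treewidth at most [n], with [D v] as component and
    [N v] as its boundary. *)
Section EliminationOrdering.
Variables (G : sgraph) (n : nat) (rank : G -> nat) (D N : G -> seq G).
Hypothesis rank_inj : injective rank.
Hypothesis D_self : forall v, v \in D v.
Hypothesis N_later : forall v u, u \in N v -> rank v < rank u.
Hypothesis D_earlier : forall v w, w \in D v -> rank w <= rank v.
Hypothesis D_boundary :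
  forall v w u, w \in D v -> adj w u -> (u \in D v) || (u \in N v).
Hypothesis N_small : forall v, size (N v) <= n.

Lemma no_complete_minor : ~ has_minor (complete_graph n.+2) G.
Proof.
case=> phi [phi_con phi_dis phi_adj].
pose top h := \max_(x in phi h) rank x.
have topP h : exists2 t, t \in phi h & top h = rank t.
  have [ne _] := phi_con h.
  have [|t tS e] := @eq_bigmax_cond _ (mem (phi h)) rank; last by exists t.
  by move: ne; rewrite card_sig.
case: (arg_minnP (P := predT) top (erefl : predT ord0)) => h0 _ h0_min.
have [v vh0 top_v] := topP h0.
have sub_h0 : {subset phi h0 <= D v}.
  apply: (@connected_subset_of_boundary _ _ _ (mem (N v)) _ _ _ v) => //.
    exact: D_boundary.
  move=> u uh0; apply/negP => /N_later; rewrite ltnNge -top_v.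
  by rewrite /top (bigmax_sup u).
have meetN h : h != h0 -> exists y, (y \in phi h) && (y \in N v).
  move=> hh0; apply/existsP; apply: contraT; rewrite negb_exists => /forallP noN.
  have [x [y [xh0 yh xy]]] : exists x y, [/\ x \in phi h0, y \in phi h & adj x y].
    by apply: phi_adj; rewrite /= /complete_adj eq_sym.
  have notN u : u \in phi h -> u \notin N v.
    by move=> uh; have := noN u; rewrite uh.
  have yD : y \in D v.
    by have := D_boundary _ _ _ (sub_h0 _ xh0) xy; rewrite (negbTE (notN _ yh)) orbF.
  have subD : {subset phi h <= D v}.
    apply: (@connected_subset_of_boundary _ _ _ (mem (N v)) _ _ _ y) => //.
    exact: D_boundary.
  (* Inside [D v], the top of [phi h] ranks at most [rank v]; by minimality it equals [v], which
     lies in the disjoint set [phi h0]. *)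
  have [t th top_t] := topP h.
  have /rank_inj tv : rank t = rank v.
    apply/eqP; rewrite eqn_leq D_earlier ?subD //= -top_v -top_t.
    exact: h0_min.
  by have := disjointFr (phi_dis _ _ hh0) th; rewrite tv vh0.
pose f h := odflt v [pick y | (y \in phi h) && (y \in N v)].
have fP h : h != h0 -> (f h \in phi h) && (f h \in N v).
  by move=> /meetN [y yP]; rewrite /f; case: pickP => [|/(_ y)] //; rewrite yP.
(* The [n.+1] branch sets other than [phi h0] are disjoint, so [f] selects distinct elements of
   [N v]: too many. *)
have : size [seq f h | h in predC1 h0] <= size (N v).
  apply: uniq_leq_size => [|_ /imageP [h hh0 ->]]; last by case/andP: (fP h hh0).
  apply/dinjectiveP => h k hh0 kh0 fhk; apply: contraTeq (hh0) => hk.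
  have /andP [fh _] := fP h hh0; have /andP [fk _] := fP k kh0.
  by rewrite fhk in fh; rewrite (disjointFr (phi_dis _ _ hk) fh) in fk.
by rewrite size_image cardC1 card_ord leqNgt ltnS N_small.
Qed.

End EliminationOrdering.

(** Following [parent] walks along edges to [root]. If [root] is its own parent, shorter walks wait
    there, so one [n] serves all vertices. *)
Lemma connected_of_parent (G : sgraph) (parent : G -> G) (root : G) (n : nat) :
  (forall v, v != root -> adj v (parent v)) ->
  (forall v, iter n parent v = root) -> connected_graph G.
Proof.
move=> parent_adj to_root; split; first by apply/card_gt0P; exists root.
have con_root v : connect (@adj G) v root.
  have := to_root v; elim: n {to_root} v => [v /= ->|k IHk v]; first exact: connect0.
  rewrite iterSr => /IHk; have [-> _|/parent_adj/connect1] := eqVneq v root.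
    exact: connect0.
  exact: connect_trans.
move=> u v; apply: connect_trans (con_root u) _.
by rewrite (sym_connect_sym (@adj_sym G)).
Qed.

Definition G18_parent (v : G18) : G18 :=
  match v with
  | (_, X_) => (false, X_)
  | (i, l) => (i, match l with
                  | C_ => A_ | D_ => B_ | E_ => C_ | F_ => D_ | G_ | H_ => E_
                  | _ => X_ end)
  end.

Lemma G18_connected : connected_graph G18.
Proof.
(* The deepest vertices of the tree are $g_2$ and $h_2$, at depth 5. *)
apply: (@connected_of_parent G18 G18_parent (false, X_) 5); by case=> [] [] [].
Qed.

Definition G18_vertices : seq G18 :=
  [seq (i, l) | i <- [:: true; false], l <- letters].

Lemma enum_G18 : Finite.enum G18 = G18_vertices.
Proof. by rewrite unlock /= /prod_enum !enumT !unlock. Qed.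

Lemma max_degree_G18 : max_degree G18 <= 3.
Proof.
apply/bigmax_leqP => v _; rewrite cardsE cardE size_filter enum_G18.
by case: v => [] [] [].
Qed.

(** A series-parallel reduction: counting fill edges, each vertex has at most two neighbours left
    when it is removed. The factor 9 puts the first half before the second. *)
Definition G18_rank (v : G18) : nat :=
  v.1 * 9 + index v.2 [:: G_; H_; E_; F_; A_; B_; C_; D_; X_].

(** [B_] is absent from the component of [C_], since both its neighbours [X_] and [D_] come
    later. *)
Definition G18_component (v : G18) : seq G18 :=
  let half i := [seq (i, l) | l <- letters] in
  match v with
  | (false, X_) => half false
  | (true, X_) => half false ++ half true
  | (i, l) => [seq (i, k) | k <-
      match l with
      | E_ => [:: E_; G_; H_]
      | F_ => [:: E_; F_; G_; H_]
      | C_ => [:: A_; C_; E_; F_; G_; H_]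
      | D_ => behead letters
      | _ => [:: l]
      end]
  end.

Definition G18_boundary (v : G18) : seq G18 :=
  match v with
  | (false, X_) => [:: (true, X_)]
  | (true, X_) => [::]
  | (i, l) => [seq (i, k) | k <-
      match l with
      | G_ | H_ => [:: E_; F_]
      | E_ => [:: C_; F_]
      | F_ => [:: C_; D_]
      | A_ => [:: X_; C_]
      | B_ | C_ => [:: X_; D_]
      | _ => [:: X_]
      end]
  end.

Lemma G18_no_K4_minor : ~ has_minor (complete_graph 4) G18.
Proof.
apply: (@no_complete_minor G18 2 G18_rank G18_component G18_boundary).
- by case=> [] [] [] [] [] [].
- by case=> [] [] [].
- by move=> v; apply/allP; case: v => [] [] [].
- by move=> v; apply/allP; case: v => [] [] [].
(* Quantifying over explicit lists turns the boundary condition into a computation for each of the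
   18 vertices. *)
- have closed_D v : all (fun w => all (fun u => G18_adj w u ==>
      (u \in G18_component v) || (u \in G18_boundary v)) G18_vertices) (G18_component v).
    by case: v => [] [] []; vm_compute.
  move=> v w u wD; apply/implyP.
  by apply: (allP (allP (closed_D v) w wD)); case: u => [] [] [].
- by case=> [] [] [].
Qed.

Lemma crumby_blue_cherry (G : sgraph) (c : G -> color) (u v w : G) :
  crumby c -> adj v u -> adj v w -> u != w ->
  [|| is_red (c u), is_red (c v) | is_red (c w)].
Proof.
case=> deg1 _ _ vu vw uw; apply: contraLR deg1; rewrite !negb_or -ltnNge.
pose B := [set x | c x == Blue].
have blueP x : ~~ is_red (c x) -> x \in B by rewrite inE; case: (c x).
case/and3P => /blueP uB /blueP vB /blueP wB.
apply: leq_trans (leq_bigmax (Sub v vB : induced B)).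
rewrite (_ : 2 = #|[set (Sub u uB : induced B); Sub w wB]|); last first.
  by rewrite cards2 -val_eqE /= uw.
by apply: subset_leq_card; apply/subsetP => x /set2P [] ->; rewrite inE.
Qed.

(** Neighbours within one half; the edge $x_1x_2$ is left out. *)
Definition half_nbr (l : letter) : seq letter :=
  match l with
  | X_ => [:: A_; B_]
  | A_ => [:: X_; C_]
  | B_ => [:: X_; D_]
  | C_ => [:: A_; D_; E_]
  | D_ => [:: B_; C_; F_]
  | E_ => [:: C_; G_; H_]
  | F_ => [:: D_; G_; H_]
  | G_ | H_ => [:: E_; F_]
  end.

Lemma G18_adj_half i u v : G18_adj (i, u) (i, v) = (v \in half_nbr u).
Proof. by case: i u v => [] [] []. Qed.

(** Here [true] means red. [X_] is exempt from the second condition because its red neighbour may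
    lie in the other half. *)
Definition half_crumby (r : letter -> bool) : bool :=
  [&& all (fun v => all (fun u => all (fun w =>
        (u != w) ==> [|| r u, r v | r w])
        (half_nbr v)) (half_nbr v)) letters,
      all (fun v => (v != X_) && r v ==> has r (half_nbr v)) letters
    & all (fun v1 => all (fun v2 => all (fun v3 => all (fun v4 =>
        uniq [:: v1; v2; v3; v4] ==> ~~ [&& r v1, r v2, r v3 & r v4])
        (half_nbr v3)) (half_nbr v2)) (half_nbr v1)) letters].

Lemma half_crumby_red (r : letter -> bool) :
  (forall u v w, u \in half_nbr v -> w \in half_nbr v -> u != w ->
    [|| r u, r v | r w]) ->
  (forall v, v != X_ -> r v -> exists2 w, w \in half_nbr v & r w) ->
  (forall v1 v2 v3 v4, v2 \in half_nbr v1 -> v3 \in half_nbr v2 -> v4 \in half_nbr v3 ->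
    uniq [:: v1; v2; v3; v4] -> ~~ [&& r v1, r v2, r v3 & r v4]) ->
  r X_ && (r A_ || r B_).
Proof.
move=> blue red path.
(* Encoding a coloring by nine booleans lets case analysis check all 512 of them; [s] then agrees
   with [r] pointwise. *)
have check x a b c d e f g h :
    let s := nth false [:: x; a; b; c; d; e; f; g; h] \o letter_index in
    half_crumby s ==> s X_ && (s A_ || s B_).
  by case: x a b c d e f g h => [] [] [] [] [] [] [] [] []; vm_compute.
have := check (r X_) (r A_) (r B_) (r C_) (r D_) (r E_) (r F_) (r G_) (r H_).
set s := _ \o _ => /implyP; apply.
have sr : s =1 r by case.
apply/and3P; split.
- apply/allP => v _; apply/allP => u vu; apply/allP => w vw.
  by apply/implyP => uw; rewrite !sr; apply: blue uw.
- apply/allP => v _; apply/implyP => /andP [vX]; rewrite sr => /(red _ vX) [w vw rw].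
  by apply/hasP; exists w; rewrite ?sr.
- apply/allP => v1 _; apply/allP => v2 v12; apply/allP => v3 v23.
  apply/allP => v4 v34; apply/implyP => uniq_v.
  by rewrite !sr; apply: path.
Qed.

Lemma crumby_half_red (c : G18 -> color) (i : bool) : crumby c ->
  is_red (c (i, X_)) && (is_red (c (i, A_)) || is_red (c (i, B_))).
Proof.
move=> cP; have [_ red path] := cP.
have redP v : is_red (c v) -> c v = Red by case: (c v).
apply: (half_crumby_red (fun l => is_red (c (i, l)))).
- move=> u v w vu vw uw; apply: (crumby_blue_cherry G18 c (i, u) (i, v) (i, w) cP).
  + by rewrite /= G18_adj_half.
  + by rewrite /= G18_adj_half.
  + by rewrite xpair_eqE eqxx.
- move=> v vX /redP /red [[j w] vw cw].
  (* Only [X_] has a neighbour in the other half. *)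
  have ji : j = i by move: vw vX {cw}; case: i j v w => [] [] [] [].
  by move: vw cw; rewrite ji /= G18_adj_half => vw cw; exists w; rewrite ?cw.
move=> v1 v2 v3 v4 v12 v23 v34 uniq_v; apply/negP => /and4P [r1 r2 r3 r4].
case: path; exists (i, v1), (i, v2), (i, v3), (i, v4).
split; [|by split; apply: redP|by rewrite /= !G18_adj_half].
by rewrite -(map_inj_uniq (f := pair i)) in uniq_v => // ? ? [].
Qed.

Theorem theorem2 :
  [/\ connected_graph G18,
      max_degree G18 <= 3,
      ~ has_minor (complete_graph 4) G18
    & ~ exists c : G18 -> color, crumby c].
Proof.
split; [exact: G18_connected | exact: max_degree_G18 | exact: G18_no_K4_minor |].
case=> c cP; have [_ _ path] := cP.
have redP v : is_red (c v) -> c v = Red by case: (c v).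
(* Recording [l != X_] gives the distinctness of the four path vertices below. *)
have neighbour i : exists2 l, l != X_ & (l \in half_nbr X_) && is_red (c (i, l)).
  by case/andP: (crumby_half_red c i cP) => _ /orP [r|r]; [exists A_ | exists B_].
have redX i : c (i, X_) = Red by case/andP: (crumby_half_red c i cP) => /redP.
have [k kX /andP [Xk /redP ck]] := neighbour false.
have [l lX /andP [Xl /redP cl]] := neighbour true.
case: path; exists (false, k), (false, X_), (true, X_), (true, l).
split; [| by split | split => //].
- by rewrite /= !inE !xpair_eqE /= (negbTE kX) [X_ == l]eq_sym (negbTE lX).
- by rewrite adj_sym /= G18_adj_half.
- by rewrite /= G18_adj_half.
Qed.
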